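(* For every forest $F$ on $n \ge 1$ vertices: (i) $\alpha_{\rm reg}(F) \ge \frac{n+2}{5}$; (ii) $\alpha_{1-\mathrm{reg}}(F) \ge \frac{2(n+2)}{9}$; and (iii) $\alpha_{k-\mathrm{reg}}(F) \ge \frac{n+2}{4}$ for every integer $k \ge 2$. Moreover, all bounds are sharp: there are infinitely many forests $F$ (with $n$ the order of $F$) satisfying $\alpha_{\rm reg}(F) = \frac{n+2}{5}$, infinitely many satisfying $\alpha_{1-\mathrm{reg}}(F) = \frac{2(n+2)}{9}$, and for every integer $k \ge 2$ infinitely many satisfying $\alpha_{k-\mathrm{reg}}(F) = \frac{n+2}{4}$.
   Context: Graphs are finite and simple. For an integer $k \ge 0$, a $k$-independent set of a graph $G$ is a set of vertices whose induced subgraph has maximum degree at most $k$. The regular $k$-independence number $\alpha_{k-\mathrm{reg}}(G)$ is the maximum cardinality of a $k$-independent set of $G$ all of whose vertices have the same degree in $G$, and $\alpha_{\rm reg}(G) = \alpha_{0-\mathrm{reg}}(G)$, i.e. the maximum cardinality of an independent set of vertices of equal degree in $G$. *)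

(* Defs.v *)
From HB Require Import structures.
From mathcomp Require Import all_boot all_order all_algebra.

Set Implicit Arguments.
Unset Strict Implicit.
Unset Printing Implicit Defensive.

Import Order.TTheory GRing.Theory Num.Theory.

Record sgraph := SGraph {
  vertex :> finType;
  edge : rel vertex;
  edge_sym : symmetric edge;
  edge_irrefl : irreflexive edge
}.

Definition iso (G H : sgraph) : Prop :=
  exists2 f : G -> H, bijective f & {mono f : u v / edge u v}.

Definition forest (G : sgraph) : Prop :=
  forall c : seq G, 2 < size c -> ~ ucycle (@edge G) c.

Definition deg (G : sgraph) (v : G) : nat := #|[set w | edge v w]|.

(* Maximum degree of the subgraph of G induced by S. *)
Definition induced_max_deg (G : sgraph) (S : {set G}) : nat :=
  \max_(v in S) #|[set w in S | edge v w]|.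

Definition k_independent (G : sgraph) (k : nat) (S : {set G}) : bool :=
  induced_max_deg S <= k.

(* Degrees are taken in the whole graph G, not in the subgraph induced by S. *)
Definition equal_degrees (G : sgraph) (S : {set G}) : bool :=
  [forall u in S, forall v in S, deg u == deg v].

Definition alpha_kreg (k : nat) (G : sgraph) : nat :=
  \max_(S : {set G} | k_independent k S && equal_degrees S) #|S|.

Definition alpha_reg (G : sgraph) : nat := alpha_kreg 0 G.

(* Graphs are counted up to isomorphism. *)
Definition infinitely_many (P : sgraph -> Prop) : Prop :=
  exists F : nat -> sgraph,
    (forall i, P (F i)) /\ (forall i j, i != j -> ~ iso (F i) (F j)).

(* Main.v *)
(* In a forest every nonempty set W of vertices spans at most |W| - 1 edges.
   Applied to a union W of components with no isolated vertex, this gives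
   |W| + 2 <= 2 w_1 + w_2, where w_d counts the vertices of degree d in W.
   So all but the vertices of degree 0, 1 and 2 can be forgotten: isolated
   vertices form an independent set, leaves a 1-independent set, and the vertices
   of degree 2 induce a linear forest, which contains an independent set with half
   of its vertices and a 1-independent set with two thirds of them. Equality forces
   maximum degree at most 3 and balanced degree classes, which suitable caterpillars
   together with isolated vertices achieve. *)

Require Import Defs.
From HB Require Import structures.
From mathcomp Require Import all_boot all_order all_algebra.
From mathcomp Require Import zify lra.

Set Implicit Arguments.
Unset Strict Implicit.
Unset Printing Implicit Defensive.

Import Order.TTheory GRing.Theory Num.Theory.
Local Open Scope ring_scope.

(** * Basic properties of [alpha_kreg], for any graph *)

Section ForestBounds.
Local Open Scope nat_scope.
Variable G : sgraph.
Implicit Types (S W A : {set G}) (u v w : G).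

Definition nbrs_in W v : {set G} := [set w in W | edge v w].

Lemma nbrs_inS W W' v : W \subset W' -> nbrs_in W v \subset nbrs_in W' v.
Proof.
move=> /subsetP sWW'; apply/subsetP => w; rewrite !inE => /andP[/sWW' -> ->].
by [].
Qed.

Lemma leq_alpha_kreg k d S :
  (forall v, v \in S -> deg v = d) ->
  (forall v, v \in S -> #|nbrs_in S v| <= k) ->
  #|S| <= alpha_kreg k G.
Proof.
move=> degS indS; rewrite /alpha_kreg.
apply: (leq_bigmax_cond (F := fun A : {set G} => #|A|)).
apply/andP; split; first exact/bigmax_leqP.
by apply/forall_inP => u uS; apply/forall_inP => v vS; rewrite !degS.
Qed.

Lemma alpha_kreg_leq k b :
  (forall S d, (forall v, v \in S -> deg v = d) ->
     (forall v, v \in S -> #|nbrs_in S v| <= k) -> #|S| <= b) ->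
  alpha_kreg k G <= b.
Proof.
move=> bnd; apply/bigmax_leqP => S /andP[/bigmax_leqP indS /forall_inP eqS].
(* The empty set has no vertex to supply the common degree. *)
have [->|[v0 v0S]] := set_0Vmem S; first by rewrite cards0.
apply: (bnd _ (deg v0)) => // v vS.
by apply/eqP; have /forall_inP := eqS _ vS; apply.
Qed.

Lemma alpha_kreg_mono k l : k <= l -> alpha_kreg k G <= alpha_kreg l G.
Proof.
move=> kl; apply: alpha_kreg_leq => S d degS indS.
by apply: (leq_alpha_kreg degS) => v /indS /leq_trans; apply.
Qed.

Lemma alpha_kreg_gt0 k : 0 < #|G| -> 0 < alpha_kreg k G.
Proof.
case/card_gt0P => v _; rewrite -(cards1 v).
apply: (@leq_alpha_kreg _ (deg v)) => [u /set1P -> // | u /set1P ->].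
rewrite (_ : nbrs_in _ _ = set0) ?cards0 //; apply/setP => w; rewrite !inE.
by case: eqP => // ->; rewrite edge_irrefl.
Qed.

(** * Peeling and edge counts in forests *)

Hypothesis forestG : forest G.

(* Extending a path greedily within [W] at an end with a second neighbour
   either never stops or closes a cycle. *)
Lemma forest_low_degree W :
  W != set0 -> exists2 v, v \in W & #|nbrs_in W v| <= 1.
Proof.
case/set0Pn => v0 v0W; apply/exists_inP; apply: contraT => /exists_inPn hW.
have two v : v \in W -> forall z, exists2 w, w \in W & edge v w && (w != z).
  move=> /hW; rewrite -ltnNge => /card_gt1P[a [b []]].
  rewrite !inE => /andP[aW ea] /andP[bW eb] ab z.
  have [az|az] := eqVneq a z; last by exists a; rewrite ?ea.
  by exists b; rewrite ?eb //= -az eq_sym.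
have long m : exists v p, [/\ size p = m, uniq (v :: p), path (@edge G) v p
    & {subset v :: p <= W}].
  elim: m => [|m [v [p [sp up pp sub]]]].
    by exists v0, [::]; split=> // w; rewrite inE => /eqP ->.
  (* The new vertex [w] must differ from the successor of [v] on the path; for empty [p] the default
     [v] is harmless. *)
  have [w wW /andP[ew wz]] := two v (sub _ (mem_head _ _)) (head v p).
  have wv : w != v by apply: contraTneq ew => ->; rewrite edge_irrefl.
  exists w, (v :: p); split.
  - by rewrite /= sp.
  - rewrite /= in up *; rewrite up inE (negPf wv) /= andbT.
    apply/negP => wp.
    (* If [w] lay on [p], the path from [v] to [w] would close up through the edge [v w]. As [w] is
       not the head of [p], [p1] is nonempty and the cycle has at least three vertices. *)
    case/splitPr: wp pp up wz {sp sub} => p1 p2.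
    rewrite cat_path /= => /and3P[pp1 e1 _] /andP[vp up] wz.
    case: p1 => [|x p1] /= in pp1 e1 vp up wz; first by rewrite eqxx in wz.
    apply: (forestG (c := v :: x :: rcons p1 w)) => //.
      by rewrite /= size_rcons.
    rewrite /ucycle /=; case/andP: pp1 => -> pp1 /=.
    rewrite !rcons_path pp1 last_rcons e1 edge_sym ew /=.
    move: vp up; rewrite -cat_rcons !inE mem_cat cat_uniq !negb_or.
    case/and3P=> -> -> _ /andP[+ /andP[-> _]].
    by rewrite mem_cat negb_or => /andP[-> _].
  - by rewrite /= edge_sym ew.
  - by move=> z; rewrite inE => /predU1P[-> // | /sub].
have [v [p [sp up _ sub]]] := long #|W|.
have /card_uniqP cvp := up.
(* The path has [#|W| + 1] distinct vertices, all in [W]. *)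
by have := subset_leq_card (introT subsetP sub); rewrite cvp /= sp ltnn.
Qed.

Lemma forest_set_ind (P : {set G} -> Prop) :
  P set0 ->
  (forall W v, v \in W -> #|nbrs_in W v| <= 1 -> P (W :\ v) -> P W) ->
  forall W, P W.
Proof.
move=> P0 PS W; have [n] := ubnP #|W|; elim: n W => // n IHn W leWn.
have [-> //|/forest_low_degree[v vW dv]] := eqVneq W set0.
apply: (PS _ v) => //; apply: IHn.
by move: leWn; rewrite (cardsD1 v W) vW.
Qed.

(** Deleting [v] lowers the degree sum by twice its inner degree, hence by at most 2, and lowers
    [2 * #|W|] by exactly 2. *)
Lemma forest_degree_sum W :
  W != set0 -> \sum_(v in W) #|nbrs_in W v| + 2 <= 2 * #|W|.
Proof.
elim/forest_set_ind: W => [|W v vW dv IH]; first by rewrite eqxx.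
move=> _.
have split_sum : \sum_(u in W) #|nbrs_in W u|
    = #|nbrs_in W v| + (\sum_(u in W :\ v) #|nbrs_in (W :\ v) u| + #|nbrs_in W v|).
  rewrite (big_setD1 v) //=; congr (_ + _).
  transitivity (\sum_(u in W :\ v) (#|nbrs_in (W :\ v) u| + edge v u)).
    apply: eq_bigr => u _; rewrite (cardsD1 v) inE vW edge_sym addnC.
    by congr (_ + _); apply: eq_card => w; rewrite !inE andbA.
  rewrite big_split /=; congr (_ + _); rewrite -big_mkcondr sum1dep_card.
  apply: eq_card => u; rewrite !inE.
  by have [->|_] //= := eqVneq u v; rewrite edge_irrefl andbF.
rewrite split_sum (cardsD1 v W) vW.
have [W0|/IH] := eqVneq (W :\ v) set0; last by lia.
rewrite W0 cards0 big_set0; suff -> : #|nbrs_in W v| = 0 by [].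
apply/eqP; rewrite cards_eq0; apply/eqP/setP => w; rewrite !inE.
have := in_set0 w; rewrite -W0 !inE; case: eqP => //= [-> _|_ -> //].
by rewrite edge_irrefl andbF.
Qed.

Lemma forest_leaves W :
  W != set0 -> (forall v, v \in W -> 0 < deg v) ->
  (forall v w, v \in W -> edge v w -> w \in W) ->
  #|W| + 2 <= 2 * #|[set v in W | deg v == 1]| + #|[set v in W | deg v == 2]|.
Proof.
move=> W0 Wpos Wclosed.
have := forest_degree_sum W0.
have -> : \sum_(v in W) #|nbrs_in W v| = \sum_(v in W) deg v.
  apply: eq_bigr => v vW; apply: eq_card => w; rewrite !inE.
  by apply: andb_idl; apply: Wclosed.
have cardsep d : #|[set v in W | deg v == d]| = \sum_(v in W) (deg v == d).
  by rewrite -big_mkcondr sum1dep_card.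
(* Pointwise, [3 <= d + 2 * (d == 1) + (d == 2)] for every degree [d > 0]. *)
have : \sum_(v in W) 3
    <= \sum_(v in W) (deg v + ((deg v == 1) + (deg v == 1)) + (deg v == 2)).
  by apply: leq_sum => v /Wpos; case: (deg v) => [|[|[|n]]].
rewrite !big_split /= -!cardsep sum_nat_const; lia.
Qed.

(** * Colourings of forests and large sparse subsets *)

Lemma forest_bipartition W : exists f : G -> bool,
  forall u v, u \in W -> v \in W -> edge u v -> f u != f v.
Proof.
elim/forest_set_ind: W => [|W v vW dv [f fP]].
  by exists xpredT => u v; rewrite inE.
(* At most one neighbour of [v] is already coloured, so one of the two colours is free. *)
have [c cP] : exists c, forall u, u \in W -> edge v u -> f u != c.
  have [N0|[u]] := set_0Vmem (nbrs_in W v).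
    by exists true => u uW eu; have := in_set0 u; rewrite -N0 !inE uW eu.
  move=> uN; exists (~~ f u) => w wW ew.
  have -> : w = u; last by case: (f u).
  by apply: (card_le1_eqP dv) => //; rewrite inE wW.
exists (fun u => if u == v then c else f u) => x y xW yW exy.
have [xv|xv] := eqVneq x v; have [yv|yv] := eqVneq y v.
- by move: exy; rewrite xv yv edge_irrefl.
- by rewrite eq_sym; apply: cP => //; rewrite -xv.
- by apply: cP => //; rewrite -yv edge_sym.
- by apply: fP; rewrite ?inE ?xv ?yv.
Qed.

Lemma forest_independent_half W :
  exists2 S : {set G}, S \subset W /\ (forall v, v \in S -> #|nbrs_in S v| <= 0)
           & #|W| <= 2 * #|S|.
Proof.
have [f fP] := forest_bipartition W.
pose A b := [set v in W | f v == b].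
have cW : #|W| = #|A true| + #|A false|.
  rewrite -(cardsID [set v | f v] W); congr (_ + _); apply: eq_card => v.
    by rewrite !inE eqb_id.
  by rewrite !inE andbC eqbF_neg.
have indA b : A b \subset W /\ (forall v, v \in A b -> #|nbrs_in (A b) v| <= 0).
  split; first by apply/subsetP => v; rewrite inE => /andP[].
  move=> v; rewrite inE leqn0 cards_eq0 => /andP[vW /eqP fv].
  apply/eqP/setP => w; rewrite !inE; apply/negP => /andP[/andP[wW /eqP fw] ew].
  by have := fP v w vW wW ew; rewrite fv fw eqxx.
case: (leqP #|A true| #|A false|) => lA.
  by exists (A false) => //; lia.
by exists (A true) => //; lia.
Qed.

(** Vertices at distance at most 2 receive different colours. The peeled vertex [v] has at most one
    neighbour [u] in [W], and [u] has at most one further neighbour, so at most two colours are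
    forbidden for [v]. *)
Lemma forest_square_3coloring W :
  (forall v, v \in W -> #|nbrs_in W v| <= 2) ->
  exists f : G -> 'I_3,
    (forall u v, u \in W -> v \in W -> edge u v -> f u != f v) /\
    (forall u v w, u \in W -> v \in W -> w \in W ->
       edge u v -> edge u w -> v != w -> f v != f w).
Proof.
elim/forest_set_ind: W => [|W v vW dv IH] degW.
  by exists (fun=> ord0); split=> u v; rewrite inE.
have sW : W :\ v \subset W by apply: subD1set.
have {IH} [u uW|f [fP fQ]] := IH.
  exact: leq_trans (subset_leq_card (nbrs_inS _ sW)) (degW _ (subsetP sW _ uW)).
have [c [cP cQ]] : exists c, (forall u, u \in W -> edge v u -> f u != c) /\
    (forall u w, u \in W -> w \in W -> edge v u -> edge u w -> w != v -> f w != c).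
  have [N0|[u uN]] := set_0Vmem (nbrs_in W v).
    have nou u : u \in W -> edge v u -> False.
      by move=> uW eu; have := in_set0 u; rewrite -N0 !inE uW eu.
    by exists ord0; split=> [u uW /nou|u w uW _ /nou]; case.
  have uniqu w : w \in W -> edge v w -> w = u.
    by move=> wW ew; apply: (card_le1_eqP dv) => //; rewrite inE wW.
  move: (uN); rewrite inE => /andP[uW eu].
  have vu : v \in nbrs_in W u by rewrite inE vW edge_sym.
  have : #|nbrs_in W u :\ v| <= 1.
    by have := degW u uW; rewrite (cardsD1 v) vu.
  move=> /card_le1_eqP du.
  have [c /andP[c1 c2]] : exists c : 'I_3,
      (c != f u) && [forall w in nbrs_in W u :\ v, c != f w].
    have [N0|[x xN]] := set_0Vmem (nbrs_in W u :\ v).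
      have : 0 < #|[set~ f u]| by rewrite cardsC1 card_ord.
      case/card_gt0P => c; rewrite !inE => cu; exists c; rewrite cu /=.
      by apply/forall_inP => w; rewrite N0 inE.
    have : 0 < #|~: [set f u; f x]|.
      by rewrite cardsCs setCK card_ord subn_gt0 cards2; case: (_ != _).
    case/card_gt0P => c; rewrite !inE negb_or => /andP[cu cx]; exists c.
    rewrite cu /=; apply/forall_inP => w wN.
    by have -> : w = x by apply: du.
  exists c; split=> [w wW /(uniqu _ wW) ->|y w yW wW /(uniqu _ yW) -> uw wv].
    by rewrite eq_sym.
  rewrite eq_sym; have /forall_inP := c2; apply.
  by rewrite !inE wv wW.
exists (fun u => if u == v then c else f u); split=> [x y xW yW exy|].
  have [xv|xv] := eqVneq x v; have [yv|yv] := eqVneq y v.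
  - by move: exy; rewrite xv yv edge_irrefl.
  - by rewrite eq_sym; apply: cP => //; rewrite -xv.
  - by apply: cP => //; rewrite -yv edge_sym.
  - by apply: fP; rewrite ?inE ?xv ?yv.
move=> u x y uW xW yW ex ey xy.
have [xv|xv] := eqVneq x v; have [yv|yv] := eqVneq y v.
- by move: xy; rewrite xv yv eqxx.
- by rewrite eq_sym; apply: (cQ u) => //; rewrite -xv edge_sym.
- by apply: (cQ u) => //; rewrite -yv edge_sym.
have [uv|uv] := eqVneq u v.
  case/eqP: xy; apply: (card_le1_eqP dv); rewrite inE ?xW ?yW -?uv //.
by apply: (fQ u); rewrite ?inE ?uv ?xv ?yv.
Qed.

(* Outside one colour class of such a colouring, all remaining neighbours of
   a vertex share the third colour, so there is at most one. *)
Lemma forest_1independent_two_thirds W :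
  (forall v, v \in W -> #|nbrs_in W v| <= 2) ->
  exists2 S : {set G}, S \subset W /\ (forall v, v \in S -> #|nbrs_in S v| <= 1)
           & 2 * #|W| <= 3 * #|S|.
Proof.
move=> /forest_square_3coloring[f [fP fQ]].
pose A c := [set v in W | f v != c].
have indA c : A c \subset W /\ (forall v, v \in A c -> #|nbrs_in (A c) v| <= 1).
  split; first by apply/subsetP => v; rewrite inE => /andP[].
  move=> v; rewrite inE => /andP[vW vc]; apply/card_le1_eqP => x y.
  rewrite !inE => /andP[/andP[xW xc] ex] /andP[/andP[yW yc] ey].
  apply/eqP; apply: contraT => xy.
  have /card_uniqP cu : uniq [:: c; f v; f x; f y].
    rewrite /= !inE !negb_or (eq_sym c) vc (eq_sym c) xc (eq_sym c) yc /=.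
    by rewrite (fP v x) // (fP v y) // (fQ v x y) // eq_sym.
  by have := max_card [in [:: c; f v; f x; f y]]; rewrite cu card_ord.
(* Each vertex of [W] misses exactly one of the three sets [A c], so the largest of them has at
   least two thirds of [W]. *)
have : \sum_(c : 'I_3) #|A c| = 2 * #|W|.
  have -> : \sum_c #|A c| = \sum_c \sum_(v in W) (f v != c).
    by apply: eq_bigr => c _; rewrite -big_mkcondr sum1dep_card.
  rewrite exchange_big /= mulnC -sum_nat_const; apply: eq_bigr => v _.
  rewrite -big_mkcondr /= sum1dep_card.
  by rewrite (_ : [set c | _] = [set~ f v]) ?cardsC1 ?card_ord //;
     apply/setP => c; rewrite !inE eq_sym.
have [c _ cmax] := @arg_maxnP _ (ord0 : 'I_3) xpredT (fun c => #|A c|) isT.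
move=> <-; exists (A c) => //.
apply: (@leq_trans (\sum_(c' : 'I_3) #|A c|)); last first.
  by rewrite sum_nat_const card_ord.
by apply: leq_sum => c' _; apply: cmax.
Qed.

(** * Degree classes and the three lower bounds *)

Definition deg_class d : {set G} := [set v | deg v == d].

Lemma leq_alpha_deg_class k d S : S \subset deg_class d ->
  (forall v, v \in S -> #|nbrs_in S v| <= k) -> #|S| <= alpha_kreg k G.
Proof.
move=> /subsetP sS; apply: leq_alpha_kreg => v /sS; rewrite inE => /eqP; exact.
Qed.

Lemma deg_class_leq_alpha d : #|deg_class d| <= alpha_kreg d G.
Proof.
apply: (leq_alpha_deg_class (subxx _)) => v; rewrite inE => /eqP <-.
by apply: subset_leq_card; apply/subsetP => w; rewrite !inE => /andP[].
Qed.

Lemma forest_leaves_nonisolated : ~: deg_class 0 != set0 ->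
  #|G| + 2 <= #|deg_class 0| + 2 * #|deg_class 1| + #|deg_class 2|.
Proof.
move=> W0; rewrite -(cardsC (deg_class 0)).
have Wpos v : v \in ~: deg_class 0 -> 0 < deg v by rewrite !inE lt0n.
have Wclosed v w : v \in ~: deg_class 0 -> edge v w -> w \in ~: deg_class 0.
  move=> _ e; rewrite !inE cards_eq0.
  by apply/set0Pn; exists v; rewrite inE edge_sym.
have sep d : 0 < d -> [set v in ~: deg_class 0 | deg v == d] = deg_class d.
  move=> d0; apply/setP => v; rewrite !inE; apply: andb_idl => /eqP ->.
  by rewrite -lt0n.
have := forest_leaves W0 Wpos Wclosed; rewrite !sep //; lia.
Qed.

(** The classes of degree 0, 1 and 2 are themselves [k]-independent, and their weights in the leaf
    count are 1 + 2 + 1 = 4. Edgeless forests are treated apart, by positivity of [alpha_kreg]. *)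
Lemma alpha_kreg2_bound k : 0 < #|G| -> 2 <= k -> #|G| + 2 <= 4 * alpha_kreg k G.
Proof.
move=> G0 k2.
have le_a d : d <= 2 -> #|deg_class d| <= alpha_kreg k G.
  move=> d2; apply: leq_trans (deg_class_leq_alpha d) _.
  by apply: alpha_kreg_mono; apply: leq_trans k2.
have a0 := alpha_kreg_gt0 k G0.
have [[l0 l1] l2] := (le_a 0 isT, le_a 1 isT, le_a 2 isT).
have [W0|/forest_leaves_nonisolated] := eqVneq (~: deg_class 0) set0; last by lia.
by rewrite -(cardsC (deg_class 0)) W0 cards0; lia.
Qed.

(** Only two thirds of the degree-2 class is guaranteed here, so the weights become 1 + 2 + 3/2 =
    9/2. *)
Lemma alpha_1reg_bound : 0 < #|G| -> 2 * (#|G| + 2) <= 9 * alpha_kreg 1 G.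
Proof.
move=> G0.
have le_a d : d <= 1 -> #|deg_class d| <= alpha_kreg 1 G.
  by move=> d2; apply: leq_trans (deg_class_leq_alpha d) (alpha_kreg_mono d2).
have a0 := alpha_kreg_gt0 1 G0.
have [|S [sS indS] cS] := @forest_1independent_two_thirds (deg_class 2).
  move=> v; rewrite inE => /eqP <-.
  by apply: subset_leq_card; apply/subsetP => w; rewrite !inE => /andP[].
have [[l0 l1] l2] := (le_a 0 isT, le_a 1 isT, leq_alpha_deg_class sS indS).
have [W0|/forest_leaves_nonisolated] := eqVneq (~: deg_class 0) set0; last by lia.
by rewrite -(cardsC (deg_class 0)) W0 cards0; lia.
Qed.

(* [K] consists of the vertices of the components [K_2]: they count only half
   among the leaves, but are removed before comparing leaves and branchings. *)
Lemma alpha_reg_bound : 0 < #|G| -> #|G| + 2 <= 5 * alpha_reg G.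
Proof.
move=> G0; rewrite /alpha_reg.
pose K := [set v in deg_class 1 | [exists w in deg_class 1, edge v w]].
have uniq_nbr v u w : v \in deg_class 1 -> edge v u -> edge v w -> u = w.
  rewrite inE => /eqP dv eu ew.
  by apply: (card_le1_eqP (eq_leq dv)); rewrite inE.
have Kclosed v w : w \in K -> edge v w -> v \in K.
  rewrite inE => /andP[w1 /exists_inP[u u1 ewu]] evw.
  have <- : u = v by apply: (uniq_nbr w) => //; rewrite edge_sym.
  rewrite inE u1 /=; apply/exists_inP; exists w => //; by rewrite edge_sym.
have n0 := deg_class_leq_alpha 0.
have a0 := alpha_kreg_gt0 0 G0.
have n2 : #|deg_class 2| <= 2 * alpha_kreg 0 G.
  have [S [sS indS] cS] := forest_independent_half (deg_class 2).
  by have := leq_alpha_deg_class sS indS; lia.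
(* All leaves outside [K] together with an independent half of [K] form an independent set, since
   adjacent leaves both lie in [K]. *)
have n1 : 2 * #|deg_class 1 :\: K| + #|K| <= 2 * alpha_kreg 0 G.
  have [A [sA indA] cA] := forest_independent_half K.
  have sAK : (deg_class 1 :\: K) :|: A \subset deg_class 1.
    rewrite subUset subsetDl /=; apply: subset_trans sA _.
    by apply/subsetP => v; rewrite inE => /andP[].
  have : #|(deg_class 1 :\: K) :|: A| <= alpha_kreg 0 G.
    apply: (leq_alpha_deg_class sAK) => v vS.
    rewrite leqn0 cards_eq0; apply/eqP/setP => w; rewrite !in_set0.
    apply/negP; rewrite inE => /andP[wS evw].
    have [v1 w1] := (subsetP sAK _ vS, subsetP sAK _ wS).
    have vK : v \in K by rewrite inE v1; apply/exists_inP; exists w.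
    have wK : w \in K by apply: (Kclosed _ v) => //; rewrite edge_sym.
    move: vS wS; rewrite !in_setU !in_setD vK wK /= => vA wA.
    have := indA _ vA; rewrite leqn0 cards_eq0 => /eqP/setP/(_ w).
    by rewrite !inE wA evw.
  have -> : #|(deg_class 1 :\: K) :|: A| = #|deg_class 1 :\: K| + #|A|.
    rewrite cardsU (_ : _ :&: A = set0) ?cards0 ?subn0 //.
    apply/setP => v; rewrite !in_setI in_setD in_set0.
    by apply/negP => /andP[/andP[/negP + _] /(subsetP sA)].
  lia.
pose W := ~: (deg_class 0 :|: K).
have cG : #|G| <= #|deg_class 0| + #|K| + #|W|.
  by rewrite -(cardsC (deg_class 0 :|: K)) leq_add2r cardsU leq_subr.
have Wpos v : v \in W -> 0 < deg v.
  by rewrite !in_setC in_setU negb_or inE lt0n => /andP[].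
have Wclosed v w : v \in W -> edge v w -> w \in W.
  rewrite !in_setC !in_setU !negb_or => /andP[v0 vK] evw; apply/andP; split.
    by rewrite inE cards_eq0; apply/set0Pn; exists v; rewrite inE edge_sym.
  by apply: contra vK => wK; apply: Kclosed evw.
(* Otherwise the leaf count on [W] and [n1] bound [#|K| + #|W| + 2] by 2 + 2 = 4 times
   [alpha_kreg 0 G]; isolated vertices add the fifth. *)
have [W0|W0] := eqVneq W set0; first by move: cG; rewrite W0 cards0; lia.
have := forest_leaves W0 Wpos Wclosed.
have -> : [set v in W | deg v == 1] = deg_class 1 :\: K.
  have inD d v : (v \in deg_class d) = (deg v == d) by rewrite inE.
  apply/setP => v; rewrite in_setD inE in_setC in_setU negb_or !inD.
  by case: eqP => [->|_]; rewrite ?andbF ?andbT.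
have : #|[set v in W | deg v == 2]| <= #|deg_class 2|.
  by apply: subset_leq_card; apply/subsetP => v; rewrite !inE => /andP[].
lia.
Qed.

End ForestBounds.

(** * Extremal caterpillars: acyclicity and degrees *)

Lemma forest_of_rank (G : sgraph) (r : G -> nat) : injective r ->
  (forall v u w : G, edge v u -> edge v w -> (r u < r v)%N -> (r w < r v)%N ->
     u = w) -> forest G.
Proof.
move=> rI below [//|c0 c] sc /andP[]; set cc := c0 :: c => cyc unc.
(* The vertex of largest rank on a cycle has two distinct neighbours of smaller rank, namely its two
   neighbours on the cycle. *)
have [m mc mmax] := @arg_maxnP _ c0 [in cc] r (mem_head _ _).
have [i p def_rot] := rot_to mc.
have sp : (2 <= size p)%N by move: sc; rewrite -(size_rot i) def_rot.
move: cyc unc; rewrite -(rot_cycle i) -(rot_uniq i) def_rot.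
have {}mmax x : x \in p -> x != m -> (r x < r m)%N.
  move=> xp xm; rewrite ltn_neqAle (inj_eq rI) xm; apply: mmax.
  suff : x \in rot i cc by rewrite mem_rot.
  by rewrite def_rot inE xp orbT.
case/lastP: p => [|p y] // in def_rot sp mmax *.
case: p => [|x p] // in def_rot sp mmax *.
rewrite /= rcons_path rcons_uniq last_rcons mem_rcons !inE !negb_or.
move=> /and3P[emx _ eym] /and3P[/andP[mx +] /andP[/eqP + _] _].
rewrite mem_rcons inE negb_or => /andP[my _]; case.
apply: (below m) => //; first by rewrite edge_sym.
  by apply: mmax; rewrite ?inE ?eqxx // eq_sym.
by apply: mmax; rewrite ?inE ?mem_rcons ?inE ?eqxx ?orbT // eq_sym.
Qed.

Section ExtremalCaterpillar.
Local Open Scope nat_scope.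
Variables q m : nat.

Let order := 3 * q + m + 4.

(* The spine is [0 .. q+m+1]; its vertices [1 .. q] carry the pendant vertices
   [q+m+2 .. 2q+m+1] and have degree 3, while [q+1 .. q+m] have degree 2; the
   last [q+2] vertices are isolated. So there are [q+2] isolated vertices, [q+2]
   leaves and [q] vertices of degree 3, and [m] is tuned to make the path of
   degree-2 vertices contribute exactly [q+2]. *)
Definition cat_arc (i j : nat) : bool :=
  (j <= q + m + 1) && (j == i.+1)
  || [&& q + m + 2 <= j, j < 2 * q + m + 2 & j == i + (q + m + 1)].

Definition cat_edge (i j : 'I_order) : bool := cat_arc i j || cat_arc j i.

Lemma cat_edge_sym : symmetric cat_edge.
Proof. by move=> i j; rewrite /cat_edge orbC. Qed.

Lemma cat_edge_irrefl : irreflexive cat_edge.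
Proof. by move=> i; rewrite /cat_edge /cat_arc; apply/negP; lia. Qed.

Definition caterpillar : sgraph := SGraph cat_edge_sym cat_edge_irrefl.

Lemma card_caterpillar : #|caterpillar| = order.
Proof. exact: card_ord. Qed.

Lemma caterpillar_ltn (i : caterpillar) : i < 3 * q + m + 4.
Proof. exact: ltn_ord. Qed.

Lemma caterpillar_forest : forest caterpillar.
Proof.
apply: (@forest_of_rank caterpillar (@nat_of_ord order)); first exact: ord_inj.
(* Arcs increase the index, and each vertex is entered by at most one arc. *)
move=> v u w; rewrite /= /cat_edge /cat_arc => e1 e2 l1 l2; apply: ord_inj; lia.
Qed.

Lemma card_leq_size (S : {set 'I_order}) (s : seq nat) :
  (forall i : 'I_order, i \in S -> nat_of_ord i \in s) -> #|S| <= size s.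
Proof.
move=> Ss; rewrite cardE -(size_map (@nat_of_ord order)); apply: uniq_leq_size.
  by rewrite (map_inj_uniq (@ord_inj order)) enum_uniq.
by move=> x /mapP[i]; rewrite mem_enum => /Ss + ->.
Qed.

Lemma size_leq_card (S : {set 'I_order}) (s : seq nat) :
  uniq s -> (forall i : nat, i \in s -> exists2 j : 'I_order, j \in S & i = j) ->
  size s <= #|S|.
Proof.
move=> us Ss; rewrite cardE -(size_map (@nat_of_ord order)).
apply: uniq_leq_size => // x /Ss[j jS ->].
by rewrite mem_map ?mem_enum //; apply: ord_inj.
Qed.

Lemma deg_caterpillar (i : 'I_order) (s : seq nat) : uniq s ->
  (forall j, (j < 3 * q + m + 4) && (cat_arc i j || cat_arc j i) = (j \in s)) ->
  @deg caterpillar i = size s.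
Proof.
move=> us sP; apply/eqP; rewrite eqn_leq; apply/andP; split.
  by apply: card_leq_size => j; rewrite inE /= /cat_edge -sP ltn_ord.
apply: size_leq_card => // j; rewrite -sP => /andP[jo e].
by exists (Ordinal jo); rewrite ?inE.
Qed.

Lemma deg_caterpillarE (i : caterpillar) : deg i =
  if i < 2 * q + m + 2 then
    if (i == 0 :> nat) || (q + m + 1 <= i) then 1
    else if i <= q then 3 else 2
  else 0.
Proof.
have io := caterpillar_ltn i.
case: ifP => h1; last first.
  by rewrite (@deg_caterpillar i [::]) // => j; rewrite in_nil /cat_arc; apply/negP; lia.
case: ifP => h2.
  have [i0|i0] := eqVneq (i : nat) 0.
    by rewrite (@deg_caterpillar i [:: 1]) // => j; rewrite inE /cat_arc; lia.
  have [i1|i1] := eqVneq (i : nat) (q + m + 1).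
    by rewrite (@deg_caterpillar i [:: q + m]) // => j; rewrite inE /cat_arc; lia.
  by rewrite (@deg_caterpillar i [:: i - (q + m + 1)]) // => j; rewrite inE /cat_arc; lia.
case: ifP => h3.
  rewrite (@deg_caterpillar i [:: i.-1; i.+1; i + (q + m + 1)]) // => [|j].
    by rewrite /= !inE; lia.
  by rewrite !inE /cat_arc; lia.
rewrite (@deg_caterpillar i [:: i.-1; i.+1]) // => [|j]; first by rewrite /= !inE; lia.
by rewrite !inE /cat_arc; lia.
Qed.

Variables (k b : nat).

(** A set of equal degrees lies in one degree class, and the classes other than degree 2 have at
    most [q + 2] vertices. Only the degree-2 segment of the spine remains to be bounded. *)
Lemma caterpillar_alpha_leq : q + 2 <= b ->
  (forall S : {set caterpillar}, (forall i, i \in S -> q + 1 <= i <= q + m) ->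
     (forall i, i \in S -> #|nbrs_in S i| <= k) -> #|S| <= b) ->
  alpha_kreg k caterpillar <= b.
Proof.
move=> qb bnd2; apply: alpha_kreg_leq => S d degS indS.
have {}degS (i : caterpillar) : i \in S -> _ :=
  fun iS => etrans (esym (deg_caterpillarE i)) (degS i iS).
have bound s : size s <= b ->
    (forall i : caterpillar, i \in S -> nat_of_ord i \in s) -> #|S| <= b.
  by move=> sb Ss; apply: leq_trans (card_leq_size Ss) sb.
case: d => [|[|[|d]]] in degS.
- apply: (bound (iota (2 * q + m + 2) (q + 2))) => [|i /degS]; rewrite ?size_iota //.
  by rewrite mem_iota; move: (caterpillar_ltn i); do ?case: ifP; lia.
- apply: (bound (0 :: iota (q + m + 1) (q + 1))) => [|i /degS].
    by rewrite /= size_iota -addnS.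
  by rewrite inE mem_iota; move: (caterpillar_ltn i); do ?case: ifP; lia.
- by apply: bnd2 => // i /degS; do ?case: ifP; lia.
(* This case is degree 3 and, vacuously, every larger degree. *)
- apply: (bound (iota 1 q)) => [|i /degS]; first by rewrite size_iota; lia.
  by rewrite mem_iota; do ?case: ifP; lia.
Qed.

End ExtremalCaterpillar.

(** * Upper bounds on the caterpillars, and sharpness *)

Lemma card_leq_blocks (T : finType) (S : {set T}) (f : T -> nat) b r :
  (forall x, x \in S -> f x < b)%N ->
  (forall j, #|[set x in S | f x == j]| <= r)%N -> (#|S| <= b * r)%N.
Proof.
move=> fb fib.
have -> : #|S| = (\sum_(j < b) #|[set x in S | f x == j]|)%N.
  under eq_bigr do rewrite -sum1_card big_mkcond.
  rewrite exchange_big -sum1_card big_mkcond /=; apply: eq_bigr => x _.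
  rewrite -big_mkcond sum1dep_card; case: ifP => [xS|xS].
    rewrite (_ : [set j | _] = [set Ordinal (fb x xS)]) ?cards1 //.
    by apply/setP => j; rewrite !inE xS -val_eqE eq_sym.
  by rewrite (_ : [set j | _] = set0) ?cards0 //; apply/setP => j; rewrite !inE xS.
rewrite -[X in (_ <= X * _)%N]card_ord -sum_nat_const.
exact: leq_sum.
Qed.

(** The degree-2 segment splits into [q + 2] pairs of adjacent vertices, each meeting an independent
    set at most once. *)
Lemma caterpillar_alpha_reg q :
  (alpha_reg (caterpillar q (2 * (q + 2))) <= q + 2)%N.
Proof.
apply: caterpillar_alpha_leq => // S Sspine indS.
suff : (#|S| <= (q + 2) * 1)%N by rewrite muln1.
apply: (card_leq_blocks (f := fun i : caterpillar q _ => (i - (q + 1)) %/ 2))%N.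
  by move=> i /Sspine; lia.
move=> j; apply/card_le1_eqP => x y; rewrite !inE => /andP[xS xj] /andP[yS yj].
apply: ord_inj; apply/eqP; apply: contraT => xy.
have := indS x xS; rewrite leqn0 cards_eq0 => /eqP/setP/(_ y).
rewrite !inE yS /= /cat_edge /cat_arc; move: (Sspine x xS) (Sspine y yS); lia.
Qed.

(** The degree-2 segment splits into [b + 1] blocks of three consecutive vertices, each contributing
    at most two; taking [q = 2 * b] makes this total equal to [q + 2]. *)
Lemma caterpillar_alpha_1reg b :
  (alpha_kreg 1 (caterpillar (2 * b) (3 * (b + 1))) <= 2 * b + 2)%N.
Proof.
apply: caterpillar_alpha_leq => // S Sspine indS.
suff : (#|S| <= (b + 1) * 2)%N by lia.
apply: (card_leq_blocks (f := fun i : caterpillar _ _ =>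
  (i - (2 * b + 1)) %/ 3))%N.
  by move=> i /Sspine; lia.
have middle x y z : x \in S -> y \in S -> z \in S -> (y + 1 = x)%N ->
    (x + 1 = z)%N -> False.
  move=> xS yS zS yx xz; have /card_le1_eqP nx := indS x xS.
  suff : y = z by move=> e; move: yx xz; rewrite e; lia.
  apply: nx; rewrite inE ?yS ?zS /= /cat_edge /cat_arc.
    by move: (Sspine x xS) (Sspine y yS); lia.
  by move: (Sspine x xS) (Sspine z zS); lia.
move=> j; rewrite leqNgt; apply/negP => /card_gt2P[x [y [z [[+ + +] []]]]].
rewrite !inE -!val_eqE /=.
move=> /andP[xS xj] /andP[yS yj] /andP[zS zj] xy yz zx.
(* Three distinct vertices of a block are consecutive in some order; all six orders are excluded. *)
have := (middle x y z xS yS zS, middle x z y xS zS yS, middle y x z yS xS zS,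
  middle y z x yS zS xS, middle z x y zS xS yS, middle z y x zS yS xS).
move: (Sspine x xS) (Sspine y yS) (Sspine z zS).
move=> ? ? ? [[[[[m1 m2] m3] m4] m5] m6].
lia.
Qed.

Lemma caterpillar_alpha_kreg q k : (alpha_kreg k (caterpillar q (q + 2)) <= q + 2)%N.
Proof.
apply: caterpillar_alpha_leq => // S Sspine _.
suff : (#|S| <= size (iota (q + 1) (q + 2)))%N by rewrite size_iota.
by apply: card_leq_size => i /Sspine; rewrite mem_iota; lia.
Qed.

(** Isomorphic graphs have equal order, and the order is [3 * q + m + 4]. *)
Lemma infinitely_many_caterpillars (P : sgraph -> Prop) (q m : nat -> nat) :
  (forall i, P (caterpillar (q i) (m i))) ->
  (forall i j, i != j -> 3 * q i + m i != 3 * q j + m j)%N ->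
  infinitely_many P.
Proof.
move=> PF inj; exists (fun i => caterpillar (q i) (m i)); split=> // i j /inj.
move=> + [f /bij_eq_card + _]; rewrite !card_caterpillar; lia.
Qed.

Theorem theorem2p2 :
  (forall F : sgraph, forest F -> (1 <= #|F|)%N ->
     [/\ (alpha_reg F)%:R >= (#|F|%:R + 2) / 5 :> rat,
         (alpha_kreg 1 F)%:R >= 2 * (#|F|%:R + 2) / 9 :> rat
       & forall k : nat, (2 <= k)%N ->
         (alpha_kreg k F)%:R >= (#|F|%:R + 2) / 4 :> rat])
  /\
  [/\ infinitely_many (fun F =>
        forest F /\ (alpha_reg F)%:R = (#|F|%:R + 2) / 5 :> rat),
      infinitely_many (fun F =>
        forest F /\ (alpha_kreg 1 F)%:R = 2 * (#|F|%:R + 2) / 9 :> rat)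
    & forall k : nat, (2 <= k)%N ->
      infinitely_many (fun F =>
        forest F /\ (alpha_kreg k F)%:R = (#|F|%:R + 2) / 4 :> rat)].
Proof.
have le_rat (a b : nat) : (a <= b)%N -> a%:R <= b%:R :> rat by rewrite ler_nat.
have eq_rat (a b : nat) : a = b -> a%:R = b%:R :> rat by move=> ->.
split=> [F forestF F0|].
  split=> [||k k2].
  - by have := le_rat _ _ (alpha_reg_bound forestF F0); rewrite natrD natrM; lra.
  - have := le_rat _ _ (alpha_1reg_bound forestF F0).
    by rewrite !natrM natrD; lra.
  - by have := le_rat _ _ (alpha_kreg2_bound forestF F0 k2); rewrite natrD natrM; lra.
have cat0 q m : (0 < #|caterpillar q m|)%N by rewrite card_caterpillar addn4.
split=> [||k k2].
(* Here [n + 2 = 5 * (i + 2)], so the lower bound meets the upper bound [i + 2]. *)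
- apply: (@infinitely_many_caterpillars _ id (fun i => 2 * (i + 2)))%N
    => [i|i j]; last by lia.
  have forestF := @caterpillar_forest i (2 * (i + 2)); split=> //.
  have := alpha_reg_bound forestF (cat0 _ _); have := caterpillar_alpha_reg i.
  rewrite card_caterpillar => h1 h2.
  suff /eq_rat : (5 * alpha_reg (caterpillar i (2 * (i + 2)))
      = 3 * i + 2 * (i + 2) + 4 + 2)%N by rewrite natrM natrD; lra.
  lia.
(* Here [n + 2 = 9 * (i + 1)], and both bounds equal [2 * (i + 1)]. *)
- apply: (@infinitely_many_caterpillars _ (muln 2) (fun i => 3 * (i + 1)))%N
    => [i|i j]; last by lia.
  have forestF := @caterpillar_forest (2 * i) (3 * (i + 1)); split=> //.
  have := alpha_1reg_bound forestF (cat0 _ _); have := caterpillar_alpha_1reg i.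
  rewrite card_caterpillar => h1 h2.
  suff /eq_rat : (9 * alpha_kreg 1 (caterpillar (2 * i) (3 * (i + 1)))
      = 2 * ((3 * (2 * i) + 3 * (i + 1) + 4) + 2))%N by rewrite natrM natrM natrD; lra.
  lia.
(* Here [n + 2 = 4 * (i + 2)], and both bounds equal [i + 2]. *)
- apply: (@infinitely_many_caterpillars _ id (addn^~ 2))%N
    => [i|i j]; last by lia.
  have forestF := @caterpillar_forest i (i + 2); split=> //.
  have := alpha_kreg2_bound forestF (cat0 _ _) k2; have := caterpillar_alpha_kreg i k.
  rewrite card_caterpillar => h1 h2.
  suff /eq_rat : (4 * alpha_kreg k (caterpillar i (i + 2))
      = 3 * i + (i + 2) + 4 + 2)%N by rewrite natrM natrD; lra.
  lia.
Qed.
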